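(* Let $k$ be a field of characteristic $p>0$, $G$ a finite group, $H\le G$ a subgroup, $A$ a commutative $k$-$H$-algebra and $B$ a commutative $k$-$G$-algebra. Let $\iota_1: A\hookrightarrow A^{\otimes\mathcal R}$ be the embedding $a\mapsto t_{\hat a}$. Then: (1) The map $$\chi:\ k_H\mathtt{alg}(A,B_{\downarrow H})\to k_G\mathtt{alg}(\mathrm{Ind}_H^{\otimes G}(A),B),\qquad \chi(\alpha)(t_\phi)=\prod_{r\in\mathcal R}\alpha(\phi(r))\cdot r\quad(\phi\in A^{\mathcal R}),$$ is a bijection with inverse $\beta\mapsto\beta\circ\iota_1$. (2) The map $$\psi:\ k_H\mathtt{alg}(B_{\downarrow H},A)\to k_G\mathtt{alg}(B,\mathrm{Ind}_H^{\times G}(A)),\qquad \psi(\alpha)(b)=\big(r\mapsto\alpha(b\cdot r^{-1})\big)_{r\in\mathcal R},$$ is a bijection with inverse $\beta\mapsto(b\mapsto\beta(b)(1_H))$. (3) The tensor induction functor $\mathrm{Ind}_H^{\otimes G}: k_H\mathtt{alg}\to k_G\mathtt{alg}$ is left adjoint, and the Frobenius induction functor $\mathrm{Ind}_H^{\times G}: k_H\mathtt{alg}\to k_G\mathtt{alg}$ is right adjoint, to the restriction functor $k_G\mathtt{alg}\to k_H\mathtt{alg}$, $B\mapsto B_{\downarrow H}$.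
   Context: For a finite group $G$, a $k$-$G$-algebra is a $k$-algebra with a right action of $G$ by $k$-algebra automorphisms; $k_G\mathtt{alg}$ is the category of commutative $k$-$G$-algebras with $G$-equivariant (unital) $k$-algebra homomorphisms, and $k_G\mathtt{alg}(A,B)$ is the set of morphisms. Fix a set $\mathcal R\subseteq G$ of representatives of the right cosets $Hr$ of $H$ in $G$, with $1_H\in\mathcal R$. For $g\in G$ define a permutation $\dot g$ of $\mathcal R$ and a function $\bar g:\mathcal R\to H$ by $rg=\bar g(r)\cdot r^{\dot g}$ for $r\in\mathcal R$. Let $A\in k_H\mathtt{alg}$ and let $A^{\mathcal R}$ be the set of functions $\mathcal R\to A$. $G$ acts on $A^{\mathcal R}$ by $\phi^g(r)=\phi(r^{\dot g^{-1}})\cdot\bar g(r^{\dot g^{-1}})$. $\mathrm{Ind}_H^{\times G}(A)$ is $A^{\mathcal R}$ with pointwise $k$-algebra structure and this $G$-action. $\mathrm{Ind}_H^{\otimes G}(A)$ is the tensor product algebra $A^{\otimes\mathcal R}=\bigotimes_{r\in\mathcal R}A$ (over $k$), with $G$-action determined by $(t_\phi)^g=t_{\phi^g}$, where $t_\phi:=\bigotimes_{r\in\mathcal R}\phi(r)$ for $\phi\in A^{\mathcal R}$. Both are functors $k_H\mathtt{alg}\to k_G\mathtt{alg}$ in the evident way (apply an $H$-morphism in every component, resp. tensor factor). For $a\in A$, $\hat a\in A^{\mathcal R}$ is the function with $\hat a(1_H)=a$ and $\hat a(r)=1_A$ for $r\neq 1_H$. *)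

(* Defs.v *)
From HB Require Import structures.
From mathcomp Require Import all_fingroup all_boot all_algebra.
From mathcomp Require Import boolp.

Set Implicit Arguments.
Unset Strict Implicit.
Unset Printing Implicit Defensive.

Import GRing.Theory.
Local Open Scope ring_scope.
Local Open Scope quotient_scope.

(* A commutative unital k-algebra is a commutative ring A with a ring         *)
(* morphism k -> A.  The library's [comAlgType] requires 1 != 0; the zero     *)
(* algebra is allowed here.                                                   *)
HB.mixin Record ComPzRing_isCAlgebra (k : fieldType) A of GRing.ComPzRing A := {
  calg_const : k -> A;
  calg_constD : {morph calg_const : c d / c + d};
  calg_constM : {morph calg_const : c d / c * d};
  calg_const1 : calg_const 1 = 1
}.

#[short(type="calgType")]
HB.structure Definition CAlgebra (k : fieldType) :=
  {A of GRing.ComPzRing A & ComPzRing_isCAlgebra k A}.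

(* The underlying k-module of an algebra.                                     *)
Definition calg_mod (k : fieldType) (A : calgType k) : Type := A.

Section CAlgMod.
Variables (k : fieldType) (A : calgType k).
Local Notation M := (calg_mod A).

HB.instance Definition _ := GRing.ComPzRing.copy M A.

Definition calg_scale (c : k) (x : M) : M := (calg_const c : A) * x.

Fact calg_scaleA c d x : calg_scale c (calg_scale d x) = calg_scale (c * d) x.
Proof. by rewrite /calg_scale calg_constM mulrA. Qed.
Fact calg_scale1 : left_id 1 calg_scale.
Proof. by move=> x; rewrite /calg_scale calg_const1 mul1r. Qed.
Fact calg_scaleDr : right_distributive calg_scale +%R.
Proof. by move=> c x y; rewrite /calg_scale mulrDr. Qed.
Fact calg_scaleDl x : {morph calg_scale^~ x : c d / c + d}.
Proof. by move=> c d; rewrite /calg_scale calg_constD mulrDl. Qed.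

HB.instance Definition _ :=
  GRing.Zmodule_isLmodule.Build k M
    calg_scaleA calg_scale1 calg_scaleDr calg_scaleDl.

Lemma calg_scalerAl (c : k) (x y : M) : c *: (x * y) = (c *: x) * y.
Proof. by rewrite /GRing.scale /= /calg_scale mulrA. Qed.

Lemma calg_scalerAr (c : k) (x y : M) : c *: (x * y) = x * (c *: y).
Proof. by rewrite mulrC calg_scalerAl mulrC. Qed.

End CAlgMod.

Definition calg_morphism (k : fieldType) (A B : calgType k) (f : A -> B) :
    Prop :=
  linear (f : calg_mod A -> calg_mod B) /\ monoid_morphism f.

Section CAlgMorphisms.
Variable k : fieldType.

Lemma calg_morphism_id (A : calgType k) : calg_morphism (@id A).
Proof. by []. Qed.

Lemma calg_morphism_comp (A B C : calgType k) (f : B -> C) (g : A -> B) :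
  calg_morphism f -> calg_morphism g -> calg_morphism (f \o g).
Proof.
move=> [fl [f1 fM]] [gl [g1 gM]]; split; last split => /=.
- by move=> c x y /=; rewrite gl fl.
- by rewrite g1 f1.
- by move=> x y /=; rewrite gM fM.
Qed.

End CAlgMorphisms.

Section FinfunCAlg.
Variables (k : fieldType) (I : finType) (A : calgType k).

Fact ffun_cmulC : @commutative {ffun I -> A} _ *%R.
Proof. by move=> f g; apply/ffunP=> i; rewrite !ffunE mulrC. Qed.

HB.instance Definition _ :=
  GRing.PzRing_hasCommutativeMul.Build {ffun I -> A} ffun_cmulC.

Definition ffun_const (c : k) : {ffun I -> A} := [ffun=> calg_const c].

Fact ffun_constD : {morph ffun_const : c d / c + d}.
Proof. by move=> c d; apply/ffunP=> i; rewrite !ffunE calg_constD. Qed.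
Fact ffun_constM : {morph ffun_const : c d / c * d}.
Proof. by move=> c d; apply/ffunP=> i; rewrite !ffunE calg_constM. Qed.
Fact ffun_const1 : ffun_const 1 = 1.
Proof. by apply/ffunP=> i; rewrite !ffunE calg_const1. Qed.

HB.instance Definition _ :=
  ComPzRing_isCAlgebra.Build k {ffun I -> A} ffun_constD ffun_constM ffun_const1.

Lemma ffun_calg_linE (c : k) (x y : calg_mod {ffun I -> A}) i :
  (c *: x + y : {ffun I -> A}) i
    = c *: (x i : calg_mod A) + (y i : calg_mod A).
Proof. by rewrite [LHS]ffunE [X in X + _]ffunE ffunE. Qed.

End FinfunCAlg.

Section FinUpd.
Variables (I : finType) (A : Type).

Definition fupd (phi : {ffun I -> A}) (i : I) (a : A) : {ffun I -> A} :=
  [ffun j => if j == i then a else phi j].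

End FinUpd.

Definition multilinear (k : fieldType) (I : finType) (A V : lmodType k)
    (F : {ffun I -> A} -> V) : Prop :=
  (forall phi i a b,
     F (fupd phi i (a + b)) = F (fupd phi i a) + F (fupd phi i b))
  /\ (forall phi i c a, F (fupd phi i (c *: a)) = c *: F (fupd phi i a)).

(* The tensor power of a module A indexed by a finite type I: formal linear   *)
(* combinations  \sum_j c_j [phi_j]  (lists of pairs (c_j, phi_j)), modulo    *)
(* the congruence generated by the laws of the free k-module on I -> A and by *)
(* multilinearity of phi |-> [phi].                                           *)
Section TensorPower.
Variables (k : fieldType) (I : finType) (A : lmodType k).

Notation raw := (seq (k * {ffun I -> A})).

Inductive tens_eq : raw -> raw -> Prop :=
| te_refl s : tens_eq s s
| te_sym s t : tens_eq s t -> tens_eq t s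
| te_trans s t u : tens_eq s t -> tens_eq t u -> tens_eq s u
| te_cat s s' t t' : tens_eq s s' -> tens_eq t t' -> tens_eq (s ++ t) (s' ++ t')
| te_catC s t : tens_eq (s ++ t) (t ++ s)
| te_coef0 phi : tens_eq [:: (0, phi)] [::]
| te_coefD c d phi : tens_eq [:: (c + d, phi)] [:: (c, phi); (d, phi)]
| te_addM c phi i a b :
    tens_eq [:: (c, fupd phi i (a + b))]
            [:: (c, fupd phi i a); (c, fupd phi i b)]
| te_scaleM c d phi i a :
    tens_eq [:: (c, fupd phi i (d *: a))] [:: (c * d, fupd phi i a)].

Definition tens_eqb (s t : raw) : bool := `[< tens_eq s t >].

Fact tens_eqb_refl : reflexive tens_eqb.
Proof. by move=> s; apply/asboolP/te_refl. Qed.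
Fact tens_eqb_sym : symmetric tens_eqb.
Proof. by move=> s t; apply/asboolP/asboolP => /te_sym. Qed.
Fact tens_eqb_trans : transitive tens_eqb.
Proof.
by move=> t s u /asboolP h1 /asboolP h2; apply/asboolP; apply: te_trans h1 h2.
Qed.

Canonical tens_equiv :=
  EquivRel tens_eqb tens_eqb_refl tens_eqb_sym tens_eqb_trans.

Definition tpow : Type := {eq_quot tens_equiv}.
HB.instance Definition _ := Choice.on tpow.
HB.instance Definition _ := EqQuotient.on tpow.

Lemma tpowP (s t : raw) : reflect (tens_eq s t) (\pi_tpow s == \pi_tpow t).
Proof. by rewrite (eqmodE tens_equiv); apply: asboolP. Qed.

Lemma tens_eqE s t : tens_eq s t -> \pi_tpow s = \pi_tpow t.
Proof. by move=> st; apply/eqP/tpowP. Qed.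

Lemma tens_reprP s : tens_eq (repr (\pi_tpow s)) s.
Proof. by apply/tpowP; rewrite reprK. Qed.

Definition raw_scale (c : k) (s : raw) : raw := [seq (c * u.1, u.2) | u <- s].

Lemma raw_scale_eq c s t :
  tens_eq s t -> tens_eq (raw_scale c s) (raw_scale c t).
Proof.
elim=> {s t} /=.
- by move=> s; apply: te_refl.
- by move=> s t _; apply: te_sym.
- by move=> s t u _ h1 _; apply: te_trans h1.
- by move=> s s' t t' _ h1 _ h2; rewrite /raw_scale !map_cat; apply: te_cat.
- by move=> s t; rewrite /raw_scale !map_cat; apply: te_catC.
- by move=> phi; rewrite mulr0; apply: te_coef0.
- by move=> a b phi; rewrite mulrDr; apply: te_coefD.
- by move=> d phi i a b; apply: te_addM.
- by move=> d d' phi i a; rewrite mulrA; apply: te_scaleM.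
Qed.

Lemma raw_scale0 s : tens_eq (raw_scale 0 s) [::].
Proof.
elim: s => [|[c phi] s IH] /=; first exact: te_refl.
rewrite mul0r -cat1s -[X in tens_eq _ X]cats0.
by apply: te_cat => //; apply: te_coef0.
Qed.

Lemma raw_scaleD c d s :
  tens_eq (raw_scale (c + d) s) (raw_scale c s ++ raw_scale d s).
Proof.
elim: s => [|[e phi] s IH] /=; first exact: te_refl.
rewrite mulrDl -cat1s; apply: te_trans (te_cat (te_coefD _ _ _) IH) _.
rewrite /= -cat1s -[X in tens_eq _ X]cat1s; apply: te_cat; first exact: te_refl.
rewrite -cat1s -[X in tens_eq _ (_ ++ X)]cat1s !catA.
by apply: te_cat; [apply: te_catC | apply: te_refl].
Qed.

Definition tpow_zero : tpow := \pi_tpow [::].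
Definition tpow_add (x y : tpow) : tpow := \pi_tpow (repr x ++ repr y).
Definition tpow_scale (c : k) (x : tpow) : tpow :=
  \pi_tpow (raw_scale c (repr x)).
Definition tpow_opp (x : tpow) : tpow := tpow_scale (- 1) x.

Lemma pi_add s t : tpow_add (\pi_tpow s) (\pi_tpow t) = \pi_tpow (s ++ t).
Proof. by apply: tens_eqE; apply: te_cat; apply: tens_reprP. Qed.

Lemma pi_scale c s : tpow_scale c (\pi_tpow s) = \pi_tpow (raw_scale c s).
Proof. by apply: tens_eqE; apply: raw_scale_eq; apply: tens_reprP. Qed.

Fact tpow_addA : associative tpow_add.
Proof.
elim/quotW=> s; elim/quotW=> t; elim/quotW=> u.
by rewrite (pi_add t u) (pi_add s t) (pi_add s) (pi_add _ u) catA.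
Qed.

Fact tpow_addC : commutative tpow_add.
Proof.
elim/quotW=> s; elim/quotW=> t; rewrite (pi_add s t) (pi_add t s).
by apply: tens_eqE; apply: te_catC.
Qed.

Fact tpow_add0 : left_id tpow_zero tpow_add.
Proof. by elim/quotW=> s; rewrite (pi_add [::] s). Qed.

Fact tpow_scaleDl x : {morph tpow_scale^~ x : c d / c + d >-> tpow_add c d}.
Proof.
elim/quotW: x => s c d; rewrite (pi_scale (c + d) s) (pi_scale c s) (pi_scale d s).
rewrite (pi_add (raw_scale c s)).
by apply: tens_eqE; apply: raw_scaleD.
Qed.

Fact tpow_scale0 x : tpow_scale 0 x = tpow_zero.
Proof. elim/quotW: x => s; rewrite pi_scale; apply: tens_eqE; exact: raw_scale0. Qed.

Fact tpow_scale1 : left_id 1 tpow_scale.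
Proof.
elim/quotW=> s; rewrite pi_scale; congr (\pi_tpow _).
by rewrite -[RHS]map_id; apply: eq_map => -[c phi] /=; rewrite mul1r.
Qed.

Fact tpow_addN : left_inverse tpow_zero tpow_opp tpow_add.
Proof.
move=> x; rewrite /tpow_opp -{2}[x]tpow_scale1 -tpow_scaleDl.
by rewrite addNr tpow_scale0.
Qed.

HB.instance Definition _ :=
  GRing.isZmodule.Build tpow tpow_addA tpow_addC tpow_add0 tpow_addN.

Fact tpow_scaleA c d x : tpow_scale c (tpow_scale d x) = tpow_scale (c * d) x.
Proof.
elim/quotW: x => s.
rewrite (pi_scale d s) (pi_scale c (raw_scale d s)) (pi_scale (c * d) s).
congr (\pi_tpow _).
by rewrite /raw_scale -map_comp; apply: eq_map => u /=; rewrite mulrA.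
Qed.

Fact tpow_scaleDr : right_distributive tpow_scale +%R.
Proof.
move=> c; elim/quotW=> s; elim/quotW=> t.
rewrite [_ + _](pi_add s t) (pi_scale c (s ++ t)) (pi_scale c s) (pi_scale c t).
rewrite [RHS](pi_add (raw_scale c s)).
by rewrite /raw_scale map_cat.
Qed.

HB.instance Definition _ :=
  GRing.Zmodule_isLmodule.Build k tpow
    tpow_scaleA tpow_scale1 tpow_scaleDr tpow_scaleDl.

Definition tpure (phi : {ffun I -> A}) : tpow := \pi_tpow [:: (1, phi)].

Lemma pi_sum s : \pi_tpow s = \sum_(u <- s) u.1 *: tpure u.2.
Proof.
elim: s => [|[c phi] s IH]; first by rewrite big_nil.
rewrite big_cons -IH /tpure.
have -> : c *: (\pi_tpow [:: (1, phi)] : tpow) = \pi_tpow [:: (c, phi)].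
  by rewrite [LHS]pi_scale /= mulr1.
by rewrite [RHS]pi_add.
Qed.

Lemma tpure_multilinear : multilinear tpure.
Proof.
split=> [phi i a b|phi i c a].
  rewrite [RHS]pi_add; apply: tens_eqE; exact: te_addM.
rewrite [RHS]pi_scale; apply: tens_eqE; apply: te_trans (te_scaleM _ _ _ _ _) _.
by rewrite /= mul1r mulr1; apply: te_refl.
Qed.

Lemma tpow_ext (V : lmodType k) (f g : tpow -> V) :
  linear f -> linear g -> (forall phi, f (tpure phi) = g (tpure phi)) -> f =1 g.
Proof.
move=> fl gl fg x; rewrite -[x]reprK pi_sum.
have lin0 (h : tpow -> V) : linear h -> h 0 = 0.
  by move=> hl; have := hl (-1) 0 0; rewrite scaler0 addr0 scaleN1r addNr.
elim: (repr x) => [|u s IH]; first by rewrite big_nil !lin0.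
by rewrite big_cons fl gl fg IH.
Qed.

Section Lift.
Variables (V : lmodType k) (F : {ffun I -> A} -> V).

Definition tlift (x : tpow) : V := \sum_(u <- repr x) u.1 *: F u.2.

Hypothesis Fml : multilinear F.

Lemma tens_eq_sum s t :
  tens_eq s t -> \sum_(u <- s) u.1 *: F u.2 = \sum_(u <- t) u.1 *: F u.2.
Proof.
have [FD FZ] := Fml; elim=> {s t}.
- by [].
- by move=> s t _ ->.
- by move=> s t u _ -> _ ->.
- by move=> s s' t t' _ h1 _ h2; rewrite !big_cat /= h1 h2.
- by move=> s t; rewrite !big_cat /= addrC.
- by move=> phi; rewrite big_seq1 big_nil scale0r.
- by move=> c d phi; rewrite !big_cons !big_nil /= !addr0 scalerDl.
- by move=> c phi i a b; rewrite !big_cons !big_nil /= !addr0 FD scalerDr.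
- by move=> c d phi i a; rewrite !big_seq1 /= FZ scalerA.
Qed.

Lemma tlift_pi s : tlift (\pi_tpow s) = \sum_(u <- s) u.1 *: F u.2.
Proof. exact/tens_eq_sum/tens_reprP. Qed.

Lemma tlift_pure phi : tlift (tpure phi) = F phi.
Proof. by rewrite tlift_pi big_seq1 scale1r. Qed.

Lemma tlift_linear : linear tlift.
Proof.
move=> c; elim/quotW=> s; elim/quotW=> t.
have -> : c *: (\pi_tpow s : tpow) + \pi_tpow t = \pi_tpow (raw_scale c s ++ t).
  by rewrite -[RHS](pi_add (raw_scale c s)) -pi_scale.
rewrite !tlift_pi big_cat /= big_map scaler_sumr; congr (_ + _).
by apply: eq_bigr => u _; rewrite /= scalerA.
Qed.

End Lift.

End TensorPower.

Section TensorMul.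
Variables (k : fieldType) (I : finType) (A : calgType k).
Local Notation M := (calg_mod A).
Local Notation T := (tpow I M).
Implicit Types phi psi : {ffun I -> M}.

Lemma fupd_mul phi psi i a :
  fupd phi i a * psi = fupd (phi * psi) i (a * psi i).
Proof. by apply/ffunP=> j; rewrite !ffunE; case: eqP => // ->. Qed.

Lemma mul_multilinear psi : multilinear (fun phi => tpure (phi * psi)).
Proof.
have [tD tZ] := @tpure_multilinear k I M.
split=> [phi i a b|phi i c a]; rewrite !fupd_mul.
  by rewrite mulrDl tD.
by rewrite -calg_scalerAl tZ.
Qed.

Definition tmulr (psi : {ffun I -> M}) (x : T) : T :=
  tlift (fun phi => tpure (phi * psi)) x.

Lemma tmulr_linear psi : linear (tmulr psi).
Proof. exact/tlift_linear/mul_multilinear. Qed.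

Lemma tmulr_pure phi psi : tmulr psi (tpure phi) = tpure (phi * psi).
Proof. exact/tlift_pure/mul_multilinear. Qed.

Lemma tmulr_multilinear x : multilinear (tmulr^~ x).
Proof.
have [tD tZ] := @tpure_multilinear k I M.
split=> [psi i a b|psi i c a]; move: x; apply: tpow_ext.
- exact: tmulr_linear.
- by move=> d x y; rewrite !tmulr_linear scalerDr addrACA.
- move=> phi; rewrite !tmulr_pure ![phi * _]mulrC !fupd_mul.
  by rewrite mulrDl tD.
- exact: tmulr_linear.
- by move=> d x y; rewrite tmulr_linear scalerDr !scalerA [d * c]mulrC.
- move=> phi; rewrite !tmulr_pure ![phi * _]mulrC !fupd_mul.
  by rewrite -calg_scalerAl tZ.
Qed.

(* Determined by  tpure phi * tpure psi = tpure (phi * psi)  and bilinearity. *)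
Definition tmul (x y : T) : T := tlift (tmulr^~ x) y.

Lemma tmul_linearr x : linear (tmul x).
Proof. exact/tlift_linear/tmulr_multilinear. Qed.

Lemma tmul_purer x psi : tmul x (tpure psi) = tmulr psi x.
Proof. exact: (tlift_pure (tmulr_multilinear x)). Qed.

Lemma tmul_pure phi psi : tmul (tpure phi) (tpure psi) = tpure (phi * psi).
Proof. by rewrite tmul_purer tmulr_pure. Qed.

Lemma tmul_linearl y : linear (tmul^~ y).
Proof.
move=> c x x'; move: y; apply: tpow_ext.
- exact: tmul_linearr.
- move=> d y y'; rewrite !tmul_linearr !scalerDr !scalerA [c * d]mulrC.
  by rewrite addrACA.
- by move=> psi; rewrite !tmul_purer tmulr_linear.
Qed.

Fact tmulC : commutative tmul.
Proof.
move=> x y; move: x; apply: tpow_ext.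
- exact: tmul_linearl.
- exact: tmul_linearr.
move=> phi; move: y; apply: tpow_ext.
- exact: tmul_linearr.
- exact: tmul_linearl.
by move=> psi; rewrite !tmul_pure mulrC.
Qed.

Fact tmulA : associative tmul.
Proof.
move=> x y z; move: x; apply: tpow_ext.
- exact: tmul_linearl.
- by move=> c x x' /=; rewrite !tmul_linearl.
move=> phi; move: y; apply: tpow_ext.
- by move=> c y y' /=; rewrite tmul_linearl tmul_linearr.
- by move=> c y y' /=; rewrite tmul_linearr tmul_linearl.
move=> psi; move: z; apply: tpow_ext.
- by move=> c z z' /=; rewrite !tmul_linearr.
- exact: tmul_linearr.
by move=> th; rewrite !tmul_pure mulrA.
Qed.

Fact tmul1 : left_id (tpure (1 : {ffun I -> M})) tmul.
Proof.
apply: tpow_ext => //; first exact: tmul_linearr.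
by move=> phi; rewrite tmul_pure mul1r.
Qed.

Fact tmulDl : left_distributive tmul +%R.
Proof. by move=> x y z; have := tmul_linearl z 1 x y; rewrite !scale1r. Qed.

HB.instance Definition _ :=
  GRing.Zmodule_isComPzRing.Build T tmulA tmulC tmul1 tmulDl.

Fact tpow_scalerAl (c : k) (x y : T) : c *: (x * y) = (c *: x) * y.
Proof.
have tz : tmul 0 y = 0.
  by have := tmul_linearl y (-1) 0 0; rewrite scaler0 addr0 scaleN1r addNr.
by have := tmul_linearl y c x 0; rewrite addr0 => h; rewrite [RHS]h tz addr0.
Qed.

Fact tpow_scalerAr (c : k) (x y : T) : c *: (x * y) = x * (c *: y).
Proof. by rewrite mulrC tpow_scalerAl mulrC. Qed.

Definition tpow_const (c : k) : T := c *: (1 : T).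

Fact tpow_constD : {morph tpow_const : c d / c + d}.
Proof. by move=> c d; rewrite /tpow_const scalerDl. Qed.
Fact tpow_constM : {morph tpow_const : c d / c * d}.
Proof.
by move=> c d; rewrite /tpow_const -tpow_scalerAl mul1r scalerA.
Qed.
Fact tpow_const1 : tpow_const 1 = 1.
Proof. by rewrite /tpow_const scale1r. Qed.

HB.instance Definition _ :=
  ComPzRing_isCAlgebra.Build k T tpow_constD tpow_constM tpow_const1.

Lemma tpow_calg_scale (c : k) (x : T) : (c *: (x : calg_mod T)) = c *: x.
Proof.
by rewrite [LHS](_ : _ = tpow_const c * x) // /tpow_const -tpow_scalerAl mul1r.
Qed.

(* The pure tensor  \bigotimes_(i : I) phi i.                                 *)
Definition tens (phi : {ffun I -> A}) : T := tpure (phi : {ffun I -> M}).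

Lemma tensM (phi psi : {ffun I -> A}) : tens (phi * psi) = tens phi * tens psi.
Proof. exact: esym (tmul_pure (phi : {ffun I -> M}) psi). Qed.

Lemma tens1 : tens 1 = 1.
Proof. by []. Qed.

Definition calg_lift (V : lmodType k) (F : {ffun I -> A} -> V) : T -> V :=
  tlift (F : {ffun I -> M} -> V).

Lemma tens_ext (V : lmodType k) (f g : T -> V) :
  linear f -> linear g -> (forall phi, f (tens phi) = g (tens phi)) -> f =1 g.
Proof. exact: tpow_ext. Qed.

End TensorMul.

Lemma tpow_calg_linear (k : fieldType) (I : finType) (A B : calgType k)
    (f : tpow I (calg_mod A) -> tpow I (calg_mod B)) :
  linear f <->
  linear (f : calg_mod (tpow I (calg_mod A)) -> calg_mod (tpow I (calg_mod B))).
Proof.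
split=> fl c x y.
  have : f ((c *: (x : calg_mod (tpow I (calg_mod A)))) + y)
    = (c *: (f x : calg_mod (tpow I (calg_mod B)))) + f y.
    by rewrite !tpow_calg_scale; apply: fl.
  by [].
by rewrite -[c *: x]tpow_calg_scale -[c *: f x]tpow_calg_scale; apply: fl.
Qed.

(* Permuting the factors and applying an algebra morphism to each of them     *)
(* induces an algebra morphism of tensor powers.                              *)
Section TensorMap.
Variables (k : fieldType) (I : finType) (A B : calgType k).
Variables (s : {perm I}) (f : I -> A -> B).
Hypothesis fP : forall i, calg_morphism (f i).

Definition fmap (phi : {ffun I -> A}) : {ffun I -> B} :=
  [ffun i => f (s i) (phi (s i))].

Definition tmap : tpow I (calg_mod A) -> tpow I (calg_mod B) :=
  calg_lift (fun phi => tens (fmap phi)).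

Lemma fmap_upd phi i a :
  fmap (fupd phi i a) = fupd (fmap phi) ((s^-1)%g i) (f i a).
Proof.
apply/ffunP=> j; rewrite !ffunE -(inj_eq (@perm_inj _ s) j) permKV.
by case: eqP => // ->.
Qed.

Lemma fmap_multilinear :
  multilinear (fun phi : {ffun I -> calg_mod A} => tens (fmap phi)).
Proof.
have [tD tZ] := @tpure_multilinear k I (calg_mod B).
have f0 i : f i 0 = 0.
  have [fl _] := fP i.
  by have := fl (-1) 0 0; rewrite scaler0 addr0 scaleN1r addNr.
split=> [phi i a b|phi i c a]; rewrite !fmap_upd; have [fl _] := fP i.
  have := fl 1 a b; rewrite !scale1r => ->; exact: tD.
have := fl c a 0; rewrite f0 !addr0 => ->; exact: tZ.
Qed.

Lemma tmap_pure phi : tmap (tens phi) = tens (fmap phi).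
Proof. exact/tlift_pure/fmap_multilinear. Qed.

Lemma fmapP : calg_morphism fmap.
Proof.
split=> [c x y|]; last split=> [|x y]; apply/ffunP=> i;
  have [fl [f1 fM]] := fP (s i).
- by rewrite ffunE ffun_calg_linE fl ffun_calg_linE !ffunE.
- by rewrite !ffunE f1.
- by rewrite !ffunE fM.
Qed.

Lemma tmapP : calg_morphism tmap.
Proof.
have tl : linear tmap by exact/tlift_linear/fmap_multilinear.
have tl' : linear (tmap : calg_mod _ -> calg_mod _) by apply/tpow_calg_linear.
have [_ [h1 hM]] := fmapP.
split=> //; split; first by rewrite -[in LHS]tens1 tmap_pure h1.
move=> x y; move: x; apply: tens_ext.
- by move=> c x x' /=; rewrite mulrDl -tpow_scalerAl tl.
- by move=> c x x' /=; rewrite tl mulrDl -tpow_scalerAl.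
move=> phi; move: y; apply: tens_ext.
- by move=> c y y' /=; rewrite mulrDr -tpow_scalerAr tl.
- by move=> c y y' /=; rewrite tl mulrDr -tpow_scalerAr.
by move=> psi; rewrite -tensM !tmap_pure hM tensM.
Qed.

End TensorMap.

Record category := Category {
  cobj :> Type;
  chom : cobj -> cobj -> Type;
  cid : forall a, chom a a;
  ccomp : forall a b c, chom b c -> chom a b -> chom a c;
  ccompA : forall a b c d (h : chom c d) (g : chom b c) (f : chom a b),
    ccomp h (ccomp g f) = ccomp (ccomp h g) f;
  ccomp1l : forall a b (f : chom a b), ccomp (cid b) f = f;
  ccomp1r : forall a b (f : chom a b), ccomp f (cid a) = f }.

Record functor (C D : category) := Functor {
  fobj :> C -> D;
  fhom : forall a b : C, chom a b -> chom (fobj a) (fobj b);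
  fhom1 : forall a, fhom (cid a) = cid (fobj a);
  fhomM : forall (a b c : C) (g : chom b c) (f : chom a b),
    fhom (ccomp g f) = ccomp (fhom g) (fhom f) }.

(* F is left adjoint to U: bijections Hom(F a, b) -> Hom(a, U b), natural in  *)
(* both variables.                                                            *)
Definition left_adjoint (C D : category) (F : functor C D) (U : functor D C) :
    Prop :=
  exists Phi : forall (a : C) (b : D), chom (F a) b -> chom a (U b),
    (forall a b, bijective (Phi a b)) /\
    (forall (a a' : C) (b b' : D)
            (f : chom a' a) (g : chom b b') (h : chom (F a) b),
       Phi a' b' (ccomp g (ccomp h (fhom F f)))
         = ccomp (fhom U g) (ccomp (Phi a b h) f)).

Definition right_adjoint (C D : category) (U : functor D C) (F : functor C D) :
    Prop := left_adjoint F U.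

(* [galg_act A x g] is x . g; library actions are right actions.              *)
Record galg (k : fieldType) (G : finGroupType) := GAlg {
  galg_sort :> calgType k;
  galg_act : {action G &-> galg_sort};
  galg_actP : forall g : G, calg_morphism (galg_act^~ g) }.

Section GAlg.
Variables (k : fieldType) (G : finGroupType).

Lemma galg_actM (A : galg k G) (x : A) g h :
  galg_act A x (g * h)%g = galg_act A (galg_act A x g) h.
Proof.
by case: A x => A [to [toi toM]] toP x /=; rewrite toM ?inE.
Qed.

Lemma galg_act1 (A : galg k G) (x : A) : galg_act A x 1%g = x.
Proof.
case: A x => A [to [toi toM]] toP x /=; apply: (toi 1%g).
by rewrite -toM ?inE // mulg1.
Qed.

Record galg_hom (A B : galg k G) := GAlgHom {
  galg_fun :> A -> B;
  galg_homP : calg_morphism galg_fun;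
  galg_homJ : forall x g, galg_fun (galg_act A x g) = galg_act B (galg_fun x) g }.

Lemma galg_hom_ext (A B : galg k G) (f g : galg_hom A B) : f =1 g -> f = g.
Proof.
case: f g => f fP fJ [g gP gJ] /= /funext fg; case: _ / fg in gP gJ *.
by congr GAlgHom; apply: Prop_irrelevance.
Qed.

Definition galg_id (A : galg k G) : galg_hom A A :=
  @GAlgHom A A id (calg_morphism_id A) (fun x g => erefl).

Fact galg_compJ (A B C : galg k G) (f : galg_hom B C) (g : galg_hom A B) x h :
  (f \o g) (galg_act A x h) = galg_act C ((f \o g) x) h.
Proof. by rewrite /= !galg_homJ. Qed.

Definition galg_comp (A B C : galg k G)
    (f : galg_hom B C) (g : galg_hom A B) : galg_hom A C :=
  GAlgHom (calg_morphism_comp (galg_homP f) (galg_homP g)) (galg_compJ f g).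

Fact galg_compA (A B C D : galg k G)
    (h : galg_hom C D) (g : galg_hom B C) (f : galg_hom A B) :
  galg_comp h (galg_comp g f) = galg_comp (galg_comp h g) f.
Proof. exact: galg_hom_ext. Qed.

Fact galg_comp1l (A B : galg k G) (f : galg_hom A B) :
  galg_comp (galg_id B) f = f.
Proof. exact: galg_hom_ext. Qed.

Fact galg_comp1r (A B : galg k G) (f : galg_hom A B) :
  galg_comp f (galg_id A) = f.
Proof. exact: galg_hom_ext. Qed.

Definition galg_cat : category :=
  Category galg_compA galg_comp1l galg_comp1r.

End GAlg.

Section Restriction.
Variables (k : fieldType) (G : finGroupType) (H : {group G}).

Section Obj.
Variable B : galg k G.

Definition res_act_fun (x : B) (h : [subg H]) : B := galg_act B x (val h).

Fact res_act1 : res_act_fun^~ 1%g =1 id.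
Proof. by move=> x; apply: galg_act1. Qed.

Fact res_actM x : act_morph res_act_fun x.
Proof. by move=> g h; apply: galg_actM. Qed.

Definition res_act : {action [subg H] &-> B} := TotalAction res_act1 res_actM.

Definition res : galg k [subg H] := @GAlg k _ B res_act (fun h => galg_actP B (val h)).

End Obj.

Definition res_hom (B C : galg k G) (f : galg_hom B C) :
    galg_hom (res B) (res C) :=
  @GAlgHom k _ (res B) (res C) f (galg_homP f) (fun x h => galg_homJ f x (val h)).

Fact res_hom1 B : res_hom (galg_id B) = galg_id (res B).
Proof. exact: galg_hom_ext. Qed.

Fact res_homM B C D (g : galg_hom C D) (f : galg_hom B C) :
  res_hom (galg_comp g f) = galg_comp (res_hom g) (res_hom f).
Proof. exact: galg_hom_ext. Qed.

Definition res_functor : functor (galg_cat k G) (galg_cat k [subg H]) :=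
  @Functor (galg_cat k G) (galg_cat k [subg H]) res res_hom res_hom1 res_homM.

End Restriction.

Record right_transversal (G : finGroupType) (H : {group G}) := RTransversal {
  rt_set :> {set G};
  rtP : is_transversal rt_set (rcosets H [set: G]) [set: G];
  rt1 : 1%g \in rt_set }.

Section Transversal.
Variables (G : finGroupType) (H : {group G}) (R : right_transversal H).

Definition reps := {r : G | r \in (R : {set G})}.
HB.instance Definition _ := Finite.on reps.

Definition rep1 : reps := exist _ 1%g (rt1 R).

Lemma rcoset_in (x : G) : (H :* x)%g \in rcosets H [set: G].
Proof. by apply/rcosetsP; exists x; rewrite ?inE. Qed.

Definition rep_of (x : G) : reps :=
  exist _ (transversal_repr 1%g R (H :* x)%g)
    (repr_mem_transversal (rtP R) 1%g (rcoset_in x)).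

Lemma rep_of_coset x : (val (rep_of x) \in H :* x)%g.
Proof. exact: (repr_mem_pblock (rtP R)) (rcoset_in x). Qed.

Lemma rep_of_uniq x (r : reps) : (val r \in H :* x)%g -> rep_of x = r.
Proof.
move=> rx; apply: val_inj => /=.
have := setI_transversal_pblock (rtP R) 1%g (rcoset_in x).
move/setP/(_ (val r)); rewrite !inE rx (valP r) => /esym/eqP e.
by rewrite {1}e.
Qed.

Definition dot_fun (g : G) (r : reps) : reps := rep_of (val r * g).

Lemma dot_fun_inj g : injective (dot_fun g).
Proof.
move=> r r' e; have := rep_of_coset (val r * g).
rewrite -/(dot_fun g r) e => h1; have h2 := rep_of_coset (val r' * g).
have : (val r * g \in H :* (val r' * g))%g.
  by apply/rcoset_eqP; rewrite -(rcoset_eqP h1) (rcoset_eqP h2).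
rewrite mem_rcoset invMg !mulgA mulgK -mem_rcoset => h.
by rewrite -(rep_of_uniq h) (rep_of_uniq (rcoset_refl H (val r'))).
Qed.

Definition dot (g : G) : {perm reps} := perm (@dot_fun_inj g).

Fact bar_subproof (g : G) (r : reps) :
  ((val r * g) * (val (dot g r))^-1 \in H)%g.
Proof. by rewrite -mem_rcoset rcoset_sym permE; apply: rep_of_coset. Qed.

Definition bar (g : G) (r : reps) : [subg H] := Subg (bar_subproof g r).

Lemma dot_barE g r : (val r * g = val (bar g r) * val (dot g r))%g.
Proof. by rewrite /= mulgKV. Qed.

Lemma dot_coset g r : (H :* val (dot g r) = H :* (val r * g))%g.
Proof. by rewrite permE; apply/rcoset_eqP/rep_of_coset. Qed.

Lemma dotM g h r : dot (g * h)%g r = dot h (dot g r).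
Proof.
rewrite permE; apply: rep_of_uniq; apply/rcoset_eqP.
by rewrite dot_coset rcosetM dot_coset -rcosetM mulgA.
Qed.

Lemma dot1 r : dot 1%g r = r.
Proof. by rewrite permE; apply: rep_of_uniq; rewrite mulg1 rcoset_refl. Qed.

Lemma barM g h r : bar (g * h)%g r = (bar g r * bar h (dot g r))%g.
Proof.
apply: val_inj => /=; rewrite dotM !mulgA; congr (_ * _)%g.
by rewrite mulgKV.
Qed.

Lemma bar1 r : bar 1%g r = 1%g.
Proof. by apply: val_inj => /=; rewrite dot1 mulg1 mulgV. Qed.

Lemma dotVM g h r : ((dot (g * h))^-1 r = (dot g)^-1 ((dot h)^-1 r))%g.
Proof. by apply: (@perm_inj _ (dot (g * h)%g)); rewrite permKV dotM !permKV. Qed.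

Lemma dotV1 r : ((dot 1)^-1 r = r)%g.
Proof. by apply: (@perm_inj _ (dot 1%g)); rewrite permKV dot1. Qed.

End Transversal.

Section Induction.
Variables (k : fieldType) (G : finGroupType) (H : {group G}).
Variable R : right_transversal H.

Section Objects.
Variable A : galg k [subg H].

Definition ind_act (phi : {ffun reps R -> A}) (g : G) : {ffun reps R -> A} :=
  [ffun r => galg_act A (phi ((dot R g)^-1 r)%g) (bar g ((dot R g)^-1 r)%g)].

Lemma ind_act1 : ind_act^~ 1%g =1 id.
Proof. by move=> phi; apply/ffunP=> r; rewrite ffunE dotV1 bar1 galg_act1. Qed.

Lemma ind_actM phi : act_morph ind_act phi.
Proof.
move=> g h; apply/ffunP=> r; rewrite !ffunE dotVM barM permKV.
by rewrite galg_actM.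
Qed.

Lemma ind_act_morphism g : calg_morphism (ind_act^~ g).
Proof. exact: (fmapP (dot R g)^-1%g (fun r => galg_actP A (bar g r))). Qed.

Definition ind_prod : galg k G :=
  @GAlg k G {ffun reps R -> A} (TotalAction ind_act1 ind_actM) ind_act_morphism.

(* The linear extension of  tens phi |-> tens (ind_act phi g). *)
Definition tind_act (x : tpow (reps R) (calg_mod A)) (g : G) :
    tpow (reps R) (calg_mod A) :=
  calg_lift (fun phi => tens (ind_act phi g)) x.

Lemma tind_act_morphism g : calg_morphism (tind_act^~ g).
Proof. exact: (tmapP (dot R g)^-1%g (fun r => galg_actP A (bar g r))). Qed.

Lemma tind_act_pure phi g : tind_act (tens phi) g = tens (ind_act phi g).
Proof. exact: (tmap_pure (dot R g)^-1%g (fun r => galg_actP A (bar g r))). Qed.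

Lemma tind_act1 : tind_act^~ 1%g =1 id.
Proof.
apply: tens_ext => //; first by case: (tind_act_morphism 1%g) => /tpow_calg_linear.
by move=> phi; rewrite tind_act_pure ind_act1.
Qed.

Lemma tind_actM x : act_morph tind_act x.
Proof.
move=> g h; move: x; apply: tens_ext.
- by case: (tind_act_morphism (g * h)%g) => /tpow_calg_linear.
- have := calg_morphism_comp (tind_act_morphism h) (tind_act_morphism g).
  by case=> /tpow_calg_linear.
by move=> phi; rewrite !tind_act_pure ind_actM.
Qed.

Definition ind_tens : galg k G :=
  @GAlg k G (tpow (reps R) (calg_mod A)) (TotalAction tind_act1 tind_actM)
    tind_act_morphism.

Definition hatf (a : A) : {ffun reps R -> A} :=
  [ffun r => if r == rep1 R then a else 1].

Definition iota1 (a : A) : ind_tens := tens (hatf a).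

End Objects.

Section Maps.
Variables (A B : galg k [subg H]) (f : galg_hom A B).

Definition ind_map (phi : {ffun reps R -> A}) : {ffun reps R -> B} :=
  [ffun r => f (phi r)].

Lemma ind_mapE : ind_map = fmap 1%g (fun _ => f).
Proof. by apply/funext => phi; apply/ffunP=> r; rewrite !ffunE perm1. Qed.

Fact ind_map_morphism : calg_morphism ind_map.
Proof. by rewrite ind_mapE; apply: fmapP => _; apply: galg_homP. Qed.

Fact ind_mapJ phi g : ind_map (ind_act phi g) = ind_act (ind_map phi) g.
Proof. by apply/ffunP=> r; rewrite !ffunE galg_homJ. Qed.

Definition ind_prod_hom : galg_hom (ind_prod A) (ind_prod B) :=
  @GAlgHom k G (ind_prod A) (ind_prod B) ind_map ind_map_morphism ind_mapJ.

(* The linear extension of  tens phi |-> tens (ind_map phi). *)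
Definition tind_map (x : tpow (reps R) (calg_mod A)) :
    tpow (reps R) (calg_mod B) :=
  calg_lift (fun phi => tens (ind_map phi)) x.

Lemma tind_mapE : tind_map = tmap 1%g (fun _ => f).
Proof. by rewrite /tind_map ind_mapE. Qed.

Fact tind_map_morphism : calg_morphism tind_map.
Proof. by rewrite tind_mapE; apply: tmapP => _; apply: galg_homP. Qed.

Lemma tind_map_pure phi : tind_map (tens phi) = tens (ind_map phi).
Proof.
by rewrite tind_mapE tmap_pure -?ind_mapE // => _; apply: galg_homP.
Qed.

Fact tind_mapJ x g : tind_map (tind_act x g) = tind_act (tind_map x) g.
Proof.
move: x; apply: tens_ext.
- by case: (calg_morphism_comp tind_map_morphism (tind_act_morphism A g))
    => /tpow_calg_linear.
- by case: (calg_morphism_comp (tind_act_morphism B g) tind_map_morphism)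
    => /tpow_calg_linear.
by move=> phi; rewrite !(tind_act_pure, tind_map_pure) ind_mapJ.
Qed.

Definition ind_tens_hom : galg_hom (ind_tens A) (ind_tens B) :=
  @GAlgHom k G (ind_tens A) (ind_tens B) tind_map tind_map_morphism tind_mapJ.

End Maps.

Fact ind_prod_hom1 A : ind_prod_hom (galg_id A) = galg_id (ind_prod A).
Proof. by apply: galg_hom_ext => phi; apply/ffunP=> r; rewrite ffunE. Qed.

Fact ind_prod_homM A B C (g : galg_hom B C) (f : galg_hom A B) :
  ind_prod_hom (galg_comp g f) = galg_comp (ind_prod_hom g) (ind_prod_hom f).
Proof. by apply: galg_hom_ext => phi; apply/ffunP=> r; rewrite !ffunE. Qed.

Definition ind_prod_functor : functor (galg_cat k [subg H]) (galg_cat k G) :=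
  @Functor (galg_cat k [subg H]) (galg_cat k G)
    ind_prod ind_prod_hom ind_prod_hom1 ind_prod_homM.

Fact ind_tens_hom1 A : ind_tens_hom (galg_id A) = galg_id (ind_tens A).
Proof.
apply: galg_hom_ext; apply: tens_ext => //.
  by case: (tind_map_morphism (galg_id A)) => /tpow_calg_linear.
move=> phi; rewrite /= tind_map_pure; congr tens.
by apply/ffunP=> r; rewrite ffunE.
Qed.

Fact ind_tens_homM A B C (g : galg_hom B C) (f : galg_hom A B) :
  ind_tens_hom (galg_comp g f) = galg_comp (ind_tens_hom g) (ind_tens_hom f).
Proof.
apply: galg_hom_ext; apply: tens_ext.
- by case: (tind_map_morphism (galg_comp g f)) => /tpow_calg_linear.
- by case: (calg_morphism_comp (tind_map_morphism g) (tind_map_morphism f))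
    => /tpow_calg_linear.
move=> phi; rewrite /= !tind_map_pure; congr tens.
by apply/ffunP=> r; rewrite !ffunE.
Qed.

Definition ind_tens_functor : functor (galg_cat k [subg H]) (galg_cat k G) :=
  @Functor (galg_cat k [subg H]) (galg_cat k G)
    ind_tens ind_tens_hom ind_tens_hom1 ind_tens_homM.

End Induction.

(* Main.v *)
(* Tensor powers are coproducts of commutative algebras, so chi(alpha) is the *)
(* algebra morphism given on the r-th factor by a |-> alpha(a) . r; it is     *)
(* equivariant because r g = bar g(r) (dot g r) and alpha commutes with H.    *)
(* Conversely 1 . r = r gives t_phi = \prod_r iota1(phi r) . r, so a          *)
(* G-morphism on the tensor induction is determined by its restriction along  *)
(* iota1.  Dually, evaluating beta(b) = beta((b . r^-1) . r) at r shows       *)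
(* beta(b)(r) = beta(b . r^-1)(1), so a G-morphism into the Frobenius         *)
(* induction is determined by its component at 1.                             *)

Require Import Defs.
From mathcomp Require Import all_fingroup all_boot all_algebra.
Import GRing.Theory.
Local Open Scope ring_scope.

Set Implicit Arguments.
Unset Strict Implicit.
Unset Printing Implicit Defensive.

(** Both bijections rest on the factorization r g = [bar g r] * [dot g r]. [prod_lift] merges the
    maps a |-> alpha(a) . r into one algebra morphism. Conversely, [prod_hatf] writes any function
    as a product of translates of functions equal to 1 off slot 1, so equivariance and
    multiplicativity recover a morphism from its composite with [iota1] ([chi_invK]). Dually, slot r
    of [beta b] is slot 1 of its translate by r^-1 ([psi_invK]). Equivariance ([chi_funJ],
    [psi_funJ]) is a reindexing along [dot g] in which [alpha] absorbs the twist [bar g]. The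
    adjunctions add naturality. *)

(** * Universal property of the tensor power *)

Section TensorCoproduct.
Variables (k : fieldType) (I : finType) (A B : calgType k).

(** The tensor power has two scalar actions, one from the quotient and one from its algebra
    structure. They agree only by a lemma, so linearity has to be transported between them. *)
Lemma tpow_calg_linear_to (V : lmodType k) (f : tpow I (calg_mod A) -> V) :
  linear (f : calg_mod (tpow I (calg_mod A)) -> V) -> linear f.
Proof. by move=> fl c x y; have := fl c x y; rewrite tpow_calg_scale. Qed.

Lemma tpow_calg_linear_from (V : lmodType k) (f : tpow I (calg_mod A) -> V) :
  linear f -> linear (f : calg_mod (tpow I (calg_mod A)) -> V).
Proof. by move=> fl c x y; rewrite tpow_calg_scale; apply: fl. Qed.

Lemma calg_morphism_tens_ext (f g : tpow I (calg_mod A) -> B) :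
  calg_morphism f -> calg_morphism g ->
  (forall phi : {ffun I -> A}, f (tens phi) = g (tens phi)) -> f =1 g.
Proof.
move=> [/tpow_calg_linear_to fl _] [/tpow_calg_linear_to gl _].
exact: (@tens_ext k I A (calg_mod B)).
Qed.

Lemma calg_morphism_prod (f : A -> B) (F : I -> A) :
  calg_morphism f -> f (\prod_i F i) = \prod_i f (F i).
Proof. by move=> [_ [f1 fM]]; apply: (big_morph f fM f1). Qed.

Variable f : I -> A -> B.

Definition prod_lift : tpow I (calg_mod A) -> B :=
  @calg_lift k I A (calg_mod B) (fun phi => \prod_i f i (phi i)).

Hypothesis fP : forall i, calg_morphism (f i).

Lemma prod_lift_multilinear :
  @multilinear k I (calg_mod A) (calg_mod B) (fun phi => \prod_i f i (phi i)).
Proof.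
(* Slot [i] enters exactly one factor, and that factor is linear. *)
have prod_fupd (phi : {ffun I -> A}) i a :
  \prod_j f j (fupd phi i a j) = f i a * \prod_(j | j != i) f j (phi j).
  rewrite (bigD1 i) //= ffunE eqxx; congr (_ * _).
  by apply: eq_bigr => j /negPf ji; rewrite ffunE ji.
split=> [phi i a b|phi i c a]; have [fl _] := fP i.
  rewrite !prod_fupd -mulrDl; congr (_ * _).
  by have := fl 1 a b; rewrite !scale1r.
rewrite !prod_fupd; apply: etrans (esym (calg_scalerAl c _ _)).
congr (_ * _).
have f0 : f i 0 = 0.
  by have := fl (-1) 0 0; rewrite scaler0 addr0 scaleN1r addNr.
by have := fl c a 0; rewrite f0 !addr0.
Qed.

Lemma prod_lift_tens (phi : {ffun I -> A}) :
  prod_lift (tens phi) = \prod_i f i (phi i).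
Proof. exact: (tlift_pure prod_lift_multilinear). Qed.

(** Multiplicativity is bilinear in the two arguments, so it is checked on pure tensors, where it is
    regrouping of a commutative product. *)
Lemma prod_lift_morphism : calg_morphism prod_lift.
Proof.
have fl : linear (prod_lift : _ -> calg_mod B).
  exact: (tlift_linear prod_lift_multilinear).
split; first exact: tpow_calg_linear_from.
split=> [|x y].
  rewrite -tens1 prod_lift_tens big1 // => i _.
  by have [_ [f1 _]] := fP i; rewrite ffunE f1.
move: x; apply: (@tens_ext k I A (calg_mod B)).
- by move=> c x x' /=; rewrite mulrDl -tpow_scalerAl fl.
- by move=> c x x'; rewrite fl mulrDl -calg_scalerAl.
move=> phi; move: y; apply: (@tens_ext k I A (calg_mod B)).
- by move=> c y y' /=; rewrite mulrDr -tpow_scalerAr fl.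
- by move=> c y y'; rewrite fl mulrDr -calg_scalerAr.
move=> psi; rewrite -tensM !prod_lift_tens -big_split /=.
by apply: eq_bigr => i _; have [_ [_ fM]] := fP i; rewrite ffunE fM.
Qed.

End TensorCoproduct.

Lemma galg_act_one (k : fieldType) (G : finGroupType) (A : galg k G) g :
  galg_act A 1 g = 1.
Proof. by have [_ [-> _]] := galg_actP A g. Qed.

(** * Permutation and cocycle at the trivial coset *)

Section Frobenius.
Variables (k : fieldType) (G : finGroupType) (H : {group G}).
Variable R : right_transversal H.

(** From 1 r = 1 r: translating by r carries slot 1 to slot r without a twist. *)
Lemma dot_rep1 (r : reps R) : dot R (val r) (rep1 R) = r.
Proof. by rewrite permE; apply: rep_of_uniq; rewrite mul1g rcoset_refl. Qed.

Lemma bar_rep1 (r : reps R) : bar (val r) (rep1 R) = 1%g.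
Proof. by apply: val_inj; rewrite /= dot_rep1 mul1g mulgV. Qed.

Lemma dot_repV (r : reps R) : dot R (val r)^-1%g r = rep1 R.
Proof. by rewrite permE; apply: rep_of_uniq; rewrite mulgV rcoset_refl. Qed.

Lemma bar_repV (r : reps R) : bar (val r)^-1%g r = 1%g.
Proof. by apply: val_inj; rewrite /= dot_repV mulgV mul1g invg1. Qed.

(** From 1 h = h 1: H fixes slot 1 and, by [bar_sub1], acts there as it does on A. *)
Lemma dot_sub1 (h : [subg H]) : dot R (val h) (rep1 R) = rep1 R.
Proof.
rewrite permE; apply: rep_of_uniq; rewrite mul1g rcoset_sym.
by rewrite mem_rcoset invg1 mulg1 (valP h).
Qed.

Lemma bar_sub1 (h : [subg H]) : bar (val h) (rep1 R) = h.
Proof. by apply: val_inj; rewrite /= dot_sub1 mul1g invg1 mulg1. Qed.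

(** * The embedding [iota1] and its translates *)

Section Objects.
Variables (A : galg k [subg H]) (B : galg k G).

(** Reading the action at the target slot [dot R g r] removes the inverse permutation. *)
Lemma ind_act_dot (phi : {ffun reps R -> A}) g r :
  ind_act phi g (dot R g r) = galg_act A (phi r) (bar g r).
Proof. by rewrite ffunE permK. Qed.

Lemma ind_act_hatf (a : A) g :
  ind_act (hatf R a) g
    = [ffun s => if s == dot R g (rep1 R)
                 then galg_act A a (bar g (rep1 R)) else 1].
Proof.
apply/ffunP=> s; rewrite -[s](permKV (dot R g)) ind_act_dot !ffunE.
by rewrite (inj_eq perm_inj); case: eqP => [->//|_]; rewrite galg_act_one.
Qed.

Lemma ind_act_hatf_sub (a : A) (h : [subg H]) :
  ind_act (hatf R a) (val h) = hatf R (galg_act A a h).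
Proof. by rewrite ind_act_hatf dot_sub1 bar_sub1. Qed.

(** The factor for r is [phi r] in slot r and 1 elsewhere, so only one factor contributes at each
    slot. *)
Lemma prod_hatf (phi : {ffun reps R -> A}) :
  \prod_r ind_act (hatf R (phi r)) (val r) = phi.
Proof.
apply/ffunP=> s.
have -> : (\prod_r ind_act (hatf R (phi r)) (val r)) s
    = \prod_r (ind_act (hatf R (phi r)) (val r) s).
  by apply: (big_morph (fun f : {ffun reps R -> A} => f s)) => [f g|];
     rewrite ffunE.
rewrite (bigD1 s) //= big1 ?mulr1 => [|r rs].
  by rewrite ind_act_hatf ffunE dot_rep1 eqxx bar_rep1 galg_act1.
by rewrite ind_act_hatf ffunE dot_rep1 eq_sym (negPf rs).
Qed.

Lemma iota1_morphism : calg_morphism (@iota1 k G H R A).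
Proof.
(* As an update of the constant function 1 in a single slot, [hatf] inherits linearity from
   multilinearity of pure tensors. *)
have hatE (a : A) : hatf R a = fupd 1 (rep1 R) a.
  by apply/ffunP=> r; rewrite !ffunE.
have [tD tZ] := @tpure_multilinear k (reps R) (calg_mod A).
split=> [c x y|]; last split=> [|x y].
- rewrite tpow_calg_scale /iota1 !hatE.
  by rewrite /tens tD tZ.
- rewrite /iota1 hatE -[RHS]tens1; congr tens.
  by apply/ffunP=> r; rewrite !ffunE if_same.
rewrite /iota1 -tensM; congr tens; apply/ffunP=> r; rewrite !ffunE.
by case: eqP; rewrite ?mulr1.
Qed.

(* Since A is commutative, multiplication A^(tensor R) -> A is an algebra     *)
(* morphism; it retracts iota1.                                               *)
Lemma iota1_inj : injective (@iota1 k G H R A).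
Proof.
apply: (can_inj (g := prod_lift (fun _ => @id A))) => a.
rewrite prod_lift_tens; last by move=> _; apply: calg_morphism_id.
rewrite (bigD1 (rep1 R)) //= big1 ?mulr1 => [|r /negPf r1]; rewrite ffunE.
  by rewrite eqxx.
by rewrite r1.
Qed.

Fact iota1J (a : A) (h : [subg H]) :
  iota1 R (galg_act A a h) = galg_act (res H (ind_tens R A)) (iota1 R a) h.
Proof. by rewrite -[LHS]/(tens _) -ind_act_hatf_sub -tind_act_pure. Qed.

Definition iota1_hom : galg_hom A (res H (ind_tens R A)) :=
  GAlgHom (B := res H (ind_tens R A)) iota1_morphism iota1J.

(** * The bijection for tensor induction *)

Section TensorTranspose.
Variable alpha : galg_hom A (res H B).

Definition chi_fun : ind_tens R A -> B :=
  prod_lift (fun (r : reps R) a => galg_act B (alpha a) (val r)).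

Lemma chi_factor_morphism (r : reps R) :
  calg_morphism (fun a => galg_act B (alpha a) (val r)).
Proof. exact: calg_morphism_comp (galg_actP B (val r)) (galg_homP alpha). Qed.

Lemma chi_fun_tens (phi : {ffun reps R -> A}) :
  chi_fun (tens phi) = \prod_r galg_act B (alpha (phi r)) (val r).
Proof. exact/prod_lift_tens/chi_factor_morphism. Qed.

Lemma chi_fun_morphism : calg_morphism chi_fun.
Proof. exact/prod_lift_morphism/chi_factor_morphism. Qed.

Fact chi_funJ x g :
  chi_fun (galg_act (ind_tens R A) x g) = galg_act B (chi_fun x) g.
Proof.
move: x; apply: calg_morphism_tens_ext.
- exact: calg_morphism_comp chi_fun_morphism (galg_actP (ind_tens R A) g).
- exact: calg_morphism_comp (galg_actP B g) chi_fun_morphism.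
move=> phi; rewrite /= tind_act_pure !chi_fun_tens.
rewrite (calg_morphism_prod _ (galg_actP B g)).
(* After reindexing, the factors match one by one: (alpha(phi r) . [bar g r]) . [dot g r] =
   (alpha(phi r) . r) . g. *)
rewrite (reindex_inj (@perm_inj _ (dot R g))); apply: eq_bigr => r _.
rewrite ind_act_dot galg_homJ -[galg_act (res H B) _ _]/(galg_act B _ _).
by rewrite -!galg_actM dot_barE.
Qed.

Definition chi : galg_hom (ind_tens R A) B := GAlgHom chi_fun_morphism chi_funJ.

End TensorTranspose.

Definition chi_inv (beta : galg_hom (ind_tens R A) B) : galg_hom A (res H B) :=
  galg_comp (res_hom H beta) iota1_hom.

Lemma chiK : cancel chi chi_inv.
Proof.
move=> alpha; apply: galg_hom_ext => a; rewrite /= chi_fun_tens.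
rewrite (bigD1 (rep1 R)) //= big1 ?mulr1 => [|r /negPf r1]; rewrite ffunE.
  by rewrite eqxx galg_act1.
by have [_ [alpha1 _]] := galg_homP alpha; rewrite r1 alpha1 galg_act_one.
Qed.

Lemma chi_invK : cancel chi_inv chi.
Proof.
move=> beta; apply: galg_hom_ext; apply: calg_morphism_tens_ext.
- exact: (galg_homP (chi (chi_inv beta))).
- exact: (galg_homP beta).
(* The pure tensor becomes a product of translates of [iota1 R (phi r)], through which [beta]
   passes. *)
move=> phi; rewrite /= chi_fun_tens -[in RHS](prod_hatf phi).
rewrite (big_morph _ (@tensM _ _ _) (@tens1 _ _ _)).
rewrite (calg_morphism_prod _ (galg_homP beta)); apply: eq_bigr => r _.
rewrite -tind_act_pure.
exact: esym (galg_homJ beta (iota1 R (phi r)) (val r)).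
Qed.

(** * The bijection for Frobenius induction *)

Section ProductTranspose.
Variable alpha : galg_hom (res H B) A.

Definition psi_fun (b : B) : ind_prod R A :=
  [ffun r : reps R => alpha (galg_act B b (val r)^-1%g)].

Lemma psi_fun_morphism : calg_morphism psi_fun.
Proof.
have fP (r : reps R) := calg_morphism_comp (galg_homP alpha)
  (galg_actP B (val r)^-1%g).
split=> [c x y|]; last split=> [|x y]; apply/ffunP=> r;
  have [fl [f1 fM]] := fP r.
- by rewrite ffun_calg_linE !ffunE; apply: fl.
- by rewrite !ffunE; apply: f1.
- by rewrite !ffunE; apply: fM.
Qed.

Fact psi_funJ b g :
  psi_fun (galg_act B b g) = galg_act (ind_prod R A) (psi_fun b) g.
Proof.
(* With r = [dot R g s], the factorization gives g r^-1 = s^-1 [bar g s]. *)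
apply/ffunP=> r; rewrite -[r](permKV (dot R g)); set s := ((dot R g)^-1%g r).
rewrite [RHS]ind_act_dot !ffunE -galg_homJ; congr (alpha _).
rewrite -[RHS]/(galg_act B _ _) -!galg_actM; congr (galg_act B b _).
by rewrite /= !mulgA mulVg mul1g.
Qed.

Definition psi : galg_hom B (ind_prod R A) := GAlgHom psi_fun_morphism psi_funJ.

End ProductTranspose.

Section ProductTransposeInverse.
Variable beta : galg_hom B (ind_prod R A).

Definition psi_inv_fun (b : res H B) : A :=
  (beta b : {ffun reps R -> A}) (rep1 R).

Lemma psi_inv_fun_morphism : calg_morphism psi_inv_fun.
Proof.
have [fl [f1 fM]] := galg_homP beta; rewrite /psi_inv_fun.
split=> [c x y|]; last split=> [|x y].
- by rewrite fl ffun_calg_linE.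
- by rewrite f1 ffunE.
- by rewrite fM ffunE.
Qed.

Fact psi_inv_funJ b h :
  psi_inv_fun (galg_act (res H B) b h) = galg_act A (psi_inv_fun b) h.
Proof.
rewrite /psi_inv_fun [beta _](galg_homJ beta b (val h)).
by rewrite -[in LHS](dot_sub1 h) [LHS]ind_act_dot bar_sub1.
Qed.

Definition psi_inv : galg_hom (res H B) A :=
  GAlgHom psi_inv_fun_morphism psi_inv_funJ.

End ProductTransposeInverse.

Lemma psiK : cancel psi psi_inv.
Proof.
move=> alpha; apply: galg_hom_ext => b.
by rewrite /= /psi_inv_fun ffunE invg1 galg_act1.
Qed.

Lemma psi_invK : cancel psi_inv psi.
Proof.
move=> beta; apply: galg_hom_ext => b; apply/ffunP=> r.
rewrite ffunE /= /psi_inv_fun galg_homJ.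
(* From r r^-1 = 1: translating by r^-1 brings slot r to slot 1 untwisted. *)
by rewrite -[in LHS](dot_repV r) [LHS]ind_act_dot bar_repV galg_act1.
Qed.

End Objects.

(** * Naturality and the adjunctions *)

Lemma ind_tens_res_adjoint :
  left_adjoint (ind_tens_functor k R) (res_functor k H).
Proof.
exists (@chi_inv); split=> [A B|A A' B B' f g h].
  by exists (@chi A B); [apply: chi_invK | apply: chiK].
apply: galg_hom_ext => a /=; rewrite tind_map_pure; congr (g (h (tens _))).
(* Naturality of [iota1]: off slot 1 it amounts to f(1) = 1. *)
apply/ffunP=> r; rewrite !ffunE; case: eqP => // _.
by have [_ [-> _]] := galg_homP f.
Qed.

Lemma ind_prod_res_adjoint :
  right_adjoint (ind_prod_functor k R) (res_functor k H).
Proof.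
exists (fun B A => @psi A B); split=> [B A|B B' A A' f g h].
  by exists (@psi_inv A B); [apply: psiK | apply: psi_invK].
(* Naturality in B is equivariance of [f] under r^-1. *)
by apply: galg_hom_ext => b; apply/ffunP=> r; rewrite !ffunE /= galg_homJ.
Qed.

End Frobenius.

Theorem theorem3p2 (k : fieldType) (p : nat) (hp : p \in [pchar k])
    (G : finGroupType) (H : {group G}) (R : right_transversal H) :
  (forall (A : galg k [subg H]) (B : galg k G),
    injective (@iota1 k G H R A) /\
    exists (chi : galg_hom A (res H B) -> galg_hom (ind_tens R A) B)
           (chi' : galg_hom (ind_tens R A) B -> galg_hom A (res H B)),
      (forall (alpha : galg_hom A (res H B)) (phi : {ffun reps R -> A}),
         chi alpha (tens phi) =
           \prod_(r : reps R) galg_act B (alpha (phi r)) (val r)) /\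
      (forall (beta : galg_hom (ind_tens R A) B) (a : A),
         chi' beta a = beta (iota1 R a)) /\
      cancel chi chi' /\ cancel chi' chi)
  /\
  (forall (A : galg k [subg H]) (B : galg k G),
    exists (psi : galg_hom (res H B) A -> galg_hom B (ind_prod R A))
           (psi' : galg_hom B (ind_prod R A) -> galg_hom (res H B) A),
      (forall (alpha : galg_hom (res H B) A) (b : B),
         (psi alpha b : {ffun reps R -> A}) =
           [ffun r : reps R => alpha (galg_act B b (val r)^-1%g)]) /\
      (forall (beta : galg_hom B (ind_prod R A)) (b : B),
         psi' beta b = (beta b : {ffun reps R -> A}) (rep1 R)) /\
      cancel psi psi' /\ cancel psi' psi)
  /\
  (left_adjoint (ind_tens_functor k R) (res_functor k H) /\
   right_adjoint (ind_prod_functor k R) (res_functor k H)).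
Proof.
split; last split; last by split;
  [apply: ind_tens_res_adjoint | apply: ind_prod_res_adjoint].
- move=> A B; split; first exact: iota1_inj.
  exists (@chi _ _ _ R A B), (@chi_inv _ _ _ R A B); split.
    exact: chi_fun_tens.
  by split=> //; split; [apply: chiK | apply: chi_invK].
- move=> A B; exists (@psi _ _ _ R A B), (@psi_inv _ _ _ R A B).
  by split=> //; split=> //; split; [apply: psiK | apply: psi_invK].
Qed.
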